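(* Let $V=(A_1|\cdots|A_m)\in\mathbf{B}$. If at least $m-1$ of the matrices $A_1,\dots,A_m$ (i.e. $A_k$ for all $k$ in some subset of $\{1,\dots,m\}$ with $m-1$ elements) belong to $\operatorname{extr}\mathbf{U}_1$, then $V\in \operatorname{extr}\mathbf{B}$.
   Context: $S^{m-1}=\{x\in\mathbb{R}^m: x_i\ge 0,\ \sum_{i=1}^m x_i=1\}$. For $x\in S^{m-1}$, $x_{[1]}\ge\cdots\ge x_{[m]}$ denotes the nonincreasing rearrangement of the coordinates of $x$; $x\prec y$ means $\sum_{i=1}^k x_{[i]}\le\sum_{i=1}^k y_{[i]}$ for every $k=1,\dots,m-1$. A quadratic stochastic operator is a map $V:S^{m-1}\to S^{m-1}$ given by $(Vx)_k=\sum_{i,j=1}^m p_{ij,k}x_ix_j$, where $p_{ij,k}=p_{ji,k}\ge 0$ and $\sum_{k=1}^m p_{ij,k}=1$; with $A_k=(p_{ij,k})_{i,j=1}^m$ one writes $V=(A_1|\cdots|A_m)$. $V$ is doubly stochastic if $Vx\prec x$ for all $x\in S^{m-1}$, and $\mathbf{B}$ is the set of all doubly stochastic quadratic operators (a convex set, with linear structure given by the coefficients $p_{ij,k}$). With $I=\{1,\dots,m\}$, $\mathbf{U}_1$ is the set of real $m\times m$ matrices $A=(a_{ij})$ with $a_{ij}=a_{ji}\ge 0$, $\sum_{i,j\in\alpha}a_{ij}\le|\alpha|$ for all $\alpha\subset I$, and $\sum_{i,j\in I}a_{ij}=m$. $\operatorname{extr}C$ denotes the set of extreme points of a convex set $C$.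 *)

(* Defs.v *)
From mathcomp Require Import all_boot all_order all_algebra.
From mathcomp Require Import classical_sets reals.
Set Implicit Arguments.
Unset Strict Implicit.
Unset Printing Implicit Defensive.
Import Order.TTheory GRing.Theory Num.Theory.
Local Open Scope classical_set_scope.
Local Open Scope ring_scope.

Definition simplex (R : realType) (m : nat) : set 'rV[R]_m :=
  [set x | (forall i, 0 <= x 0 i) /\ \sum_(i < m) x 0 i = 1].

(* Indexed from 0: [rearr x k] is x_[k+1]. *)
Definition rearr (R : realType) (m : nat) (x : 'rV[R]_m) (k : nat) : R :=
  nth 0 (sort (fun a b : R => b <= a) [seq x 0 i | i <- enum 'I_m]) k.

(* The totals are not compared: they are both 1 on the simplex. *)
Definition majorized (R : realType) (m : nat) (x y : 'rV[R]_m) : Prop :=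
  forall k : nat, (0 < k < m)%N ->
    \sum_(i < k) rearr x i <= \sum_(i < k) rearr y i.

(* A quadratic operator V = (A_1|...|A_m) is represented by its coefficients,
   p_{ij,k} = A k i j, which (being symmetric in i and j) are determined by the
   map V on the simplex.  The linear structure on operators is the lmodType
   structure of this type. *)
Definition coeffs (R : realType) (m : nat) := {ffun 'I_m -> 'M[R]_m}.

Definition qop (R : realType) (m : nat) (A : coeffs R m) (x : 'rV[R]_m) :
    'rV[R]_m :=
  \row_k \sum_(i < m) \sum_(j < m) A k i j * x 0 i * x 0 j.

Definition quadratic_stochastic (R : realType) (m : nat) (A : coeffs R m) :
    Prop :=
  [/\ forall k i j, A k i j = A k j i,
      forall k i j, 0 <= A k i j
    & forall i j, \sum_(k < m) A k i j = 1].

Lemma qop_simplex (R : realType) (m : nat) (A : coeffs R m) (x : 'rV[R]_m) :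
  quadratic_stochastic A -> simplex x -> simplex (qop A x).
Proof.
move=> [_ A0 A1] [x0 x1]; split=> [k|].
  rewrite mxE; apply: sumr_ge0 => i _; apply: sumr_ge0 => j _.
  by rewrite !mulr_ge0.
under eq_bigr do rewrite mxE.
rewrite exchange_big /= -[RHS]x1; apply: eq_bigr => i _.
rewrite exchange_big /= -[RHS]mulr1 -x1 mulr_sumr; apply: eq_bigr => j _.
by rewrite -!mulr_suml A1 mul1r.
Qed.

(* The set B of all doubly stochastic quadratic operators. *)
Definition dstoch_ops (R : realType) (m : nat) : set (coeffs R m) :=
  [set A | quadratic_stochastic A /\
           forall x, simplex x -> majorized (qop A x) x].

Definition U1_mx (R : realType) (m : nat) : set 'M[R]_m :=
  [set a | [/\ forall i j, a i j = a j i,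
               forall i j, 0 <= a i j,
               forall alpha : {set 'I_m},
                 \sum_(i in alpha) \sum_(j in alpha) a i j <= #|alpha|%:R
             & \sum_(i < m) \sum_(j < m) a i j = m%:R]].

Definition extr (R : realType) (E : lmodType R) (C : set E) : set E :=
  [set x | C x /\
     forall (y z : E) (t : R), C y -> C z -> 0 < t < 1 ->
       x = t *: y + (1 - t) *: z -> y = x /\ z = x].

(* Main.v *)
Require Import Defs.
From mathcomp Require Import all_boot all_order all_algebra.
From mathcomp Require Import classical_sets reals.
Set Implicit Arguments.
Unset Strict Implicit.
Unset Printing Implicit Defensive.
Import Order.TTheory GRing.Theory Num.Theory.
Local Open Scope classical_set_scope.
Local Open Scope ring_scope.

(** The point is that every component [A k] of a doubly stochastic operator
    lies in [U1_mx] ([dstoch_ops_U1]).  To see this, apply [A] to the barycenter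
    [u] of the face of the simplex spanned by a nonempty set [alpha] of
    vertices: the largest coordinate of [u] is [1 / |alpha|], while the [k]-th
    coordinate of the image of [u] is the sum of [A k] over
    [alpha * alpha], divided by [|alpha| ^ 2].  Majorization, used only for
    the largest coordinate ([majorized_coord_le]), gives the inequalities
    that define [U1_mx].  The [m] total sums are thus at most [m] each; as
    they add up to [m ^ 2], all of them are equal to [m].

    If now [A] is a proper convex combination of [Y] and [Z] in [dstoch_ops],
    then for [k \in K] the matrix [A k] is the same combination of
    [Y k] and [Z k], both in [U1_mx], and extremality of [A k] forces
    [Y k = A k = Z k].  The one remaining component is determined by the
    others, because the components of a stochastic operator add up to the
    all-ones matrix ([quadratic_stochastic_eq]). *)

Lemma coord_le_rearr0 (R : realType) (m : nat) (x : 'rV[R]_m) (k : 'I_m) :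
  x 0 k <= rearr x 0.
Proof.
rewrite /rearr; set s := [seq _ | _ <- _].
have tr : transitive (fun a b : R => b <= a).
  by move=> a b c ba ac; exact: le_trans ac ba.
have srt : sorted (fun a b : R => b <= a) (sort (fun a b : R => b <= a) s).
  by apply: sort_sorted => a b; exact: le_total.
have: x 0 k \in sort (fun a b : R => b <= a) s.
  by rewrite mem_sort map_f // mem_enum.
case: (sort _ _) srt => [//|a l] /= /(order_path_min tr)/allP al.
by rewrite inE => /predU1P[->//|/al].
Qed.

Lemma rearr0_le (R : realType) (m : nat) (x : 'rV[R]_m) (c : R) :
  (0 < m)%N -> (forall i, x 0 i <= c) -> rearr x 0 <= c.
Proof.
move=> m0 xc; rewrite /rearr; set s := [seq _ | _ <- _].
have: nth 0 (sort (fun a b : R => b <= a) s) 0 \in s.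
  rewrite -(mem_sort (fun a b : R => b <= a)) mem_nth //.
  by rewrite size_sort size_map -cardE card_ord.
by move=> /mapP[i _ ->].
Qed.

(** For [m = 1] the relation [majorized] compares nothing, whence [1 < m]. *)
Lemma majorized_coord_le (R : realType) (m : nat) (x y : 'rV[R]_m) (c : R) :
  (1 < m)%N -> majorized x y -> (forall i, y 0 i <= c) ->
  forall k, x 0 k <= c.
Proof.
move=> m1 /(_ 1%N m1); rewrite !big_ord1 => xy yc k.
apply: le_trans (coord_le_rearr0 x k) (le_trans xy _).
by apply: rearr0_le => //; exact: ltnW.
Qed.

Definition face_barycenter (R : realType) (m : nat) (alpha : {set 'I_m}) :
    'rV[R]_m :=
  \row_i (if i \in alpha then #|alpha|%:R^-1 else 0).

Lemma face_barycenter_simplex (R : realType) (m : nat) (alpha : {set 'I_m}) :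
  (0 < #|alpha|)%N -> simplex (face_barycenter R alpha).
Proof.
move=> a0; split=> [i|].
  by rewrite mxE; case: ifP; rewrite ?invr_ge0 ?ler0n.
under eq_bigr do rewrite mxE.
rewrite -big_mkcond /= sumr_const -[LHS]mulr_natl mulfV //.
by rewrite pnatr_eq0 -lt0n.
Qed.

Lemma qop_face_barycenter (R : realType) (m : nat) (A : coeffs R m)
    (alpha : {set 'I_m}) (k : 'I_m) :
  qop A (face_barycenter R alpha) 0 k =
  (\sum_(i in alpha) \sum_(j in alpha) A k i j) / #|alpha|%:R ^+ 2.
Proof.
rewrite mxE mulr_suml [RHS]big_mkcond /=; apply: eq_bigr => i _.
case: ifP => ia.
  rewrite mulr_suml [RHS]big_mkcond /=; apply: eq_bigr => j _.
  rewrite !mxE ia; case: ifP => ja; last by rewrite mulr0.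
  by rewrite -mulrA -invfM.
by apply: big1 => j _; rewrite !mxE ia mulr0 mul0r.
Qed.

Lemma dstoch_ops_block_sum_le (R : realType) (m : nat) (A : coeffs R m) :
  (1 < m)%N -> @dstoch_ops R m A -> forall k (alpha : {set 'I_m}),
  \sum_(i in alpha) \sum_(j in alpha) A k i j <= #|alpha|%:R.
Proof.
move=> m1 [_ Amaj] k alpha.
have [alpha0|a0] := posnP #|alpha|.
  by rewrite (cards0_eq alpha0) big_set0 cards0.
have le_inv : qop A (face_barycenter R alpha) 0 k <= #|alpha|%:R^-1.
  apply: (majorized_coord_le m1).
    exact/Amaj/face_barycenter_simplex.
  by move=> i; rewrite mxE; case: ifP; rewrite ?invr_ge0 ?ler0n.
have an0 : 0 < #|alpha|%:R :> R by rewrite ltr0n.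
move: le_inv; rewrite qop_face_barycenter ler_pdivrMr ?exprn_gt0 //.
by rewrite expr2 mulKf ?gt_eqF.
Qed.

(** Equality in the total sum is forced: the [m] totals are at most [m] each,
    and stochasticity makes them add up to [m ^ 2]. *)
Lemma dstoch_ops_total_sum (R : realType) (m : nat) (A : coeffs R m) :
  (1 < m)%N -> @dstoch_ops R m A -> forall k,
  \sum_(i < m) \sum_(j < m) A k i j = m%:R.
Proof.
move=> m1 AB; have [[_ _ A1] _] := AB.
have slack_ge0 k : 0 <= m%:R - \sum_(i < m) \sum_(j < m) A k i j.
  rewrite subr_ge0; have := dstoch_ops_block_sum_le m1 AB k [set: 'I_m].
  rewrite cardsT card_ord; congr (_ <= _).
  apply: eq_big => [i|i _]; first by rewrite inE.
  by apply: eq_bigl => j; rewrite inE.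
have slack0 : \sum_(k < m) (m%:R - \sum_(i < m) \sum_(j < m) A k i j) = 0 :> R.
  rewrite sumrB exchange_big /=.
  under [X in _ - X]eq_bigr => i _.
    rewrite exchange_big /=; under eq_bigr do rewrite A1.
    by rewrite sumr_const card_ord; over.
  by rewrite subrr.
move=> k; apply/esym/eqP; rewrite -subr_eq0; apply/eqP.
by apply: (psumr_eq0P _ slack0).
Qed.

Lemma dstoch_ops_U1 (R : realType) (m : nat) (A : coeffs R m) :
  (1 < m)%N -> @dstoch_ops R m A -> forall k, @U1_mx R m (A k).
Proof.
move=> m1 AB k; have [[Asym A0 _] _] := AB.
split; [exact: Asym|exact: A0|exact: dstoch_ops_block_sum_le|].
exact: dstoch_ops_total_sum.
Qed.

Lemma quadratic_stochastic_eq (R : realType) (m : nat) (A B : coeffs R m)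
    (k0 : 'I_m) :
  quadratic_stochastic A -> quadratic_stochastic B ->
  (forall k, k != k0 -> A k = B k) -> A = B.
Proof.
move=> [_ _ A1] [_ _ B1] AB; apply/ffunP => k.
have [->|/AB//] := eqVneq k k0; apply/matrixP => i j.
have := A1 i j; rewrite -(B1 i j) (bigD1 k0) //= [RHS](bigD1 k0) //=.
by rewrite (eq_bigr (fun l => B l i j)) => [/addIr//|l /AB->].
Qed.

Theorem theorem4p6 (R : realType) (m : nat) (hm : (0 < m)%N)
    (A : coeffs R m) (hA : @dstoch_ops R m A)
    (K : {set 'I_m}) (hK : #|K| = m.-1)
    (hext : forall k : 'I_m, k \in K -> extr (@U1_mx R m) (A k)) :
  extr (@dstoch_ops R m) A.
Proof.
split=> // Y Z t YB ZB t01 AYZ.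
have [k0 Kk0] : exists k0, ~: K = [set k0]%SET.
  apply/cards1P; have := cardsC K.
  by rewrite hK card_ord -[in RHS](prednK hm) -addn1 => /addnI ->.
have inK k : k != k0 -> k \in K.
  by apply: contraR => kK; rewrite -finset.in_set1 -Kk0 finset.in_setC.
have YZ k : k != k0 -> Y k = A k /\ Z k = A k.
  move=> /inK kK; have [_ Aext] := hext k kK.
  (* For m = 1 the set K is empty. *)
  have m1 : (1 < m)%N.
    by rewrite -(prednK hm) ltnS -hK card_gt0; apply/set0Pn; exists k.
  by apply: (Aext _ _ t); rewrite ?AYZ ?ffunE //; exact: dstoch_ops_U1.
by split; apply: (@quadratic_stochastic_eq _ _ _ _ k0);
  [case: YB|case: hA|move=> k /YZ[]|case: ZB|case: hA|move=> k /YZ[]].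
Qed.
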